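(* Let $(X,d)$ be a complete, connected, locally compact, non-compact geodesic space, and let $\rho:X\times X\to\mathbb{R}$ be the pseudo-metric $\rho(x_0,x_1)=-\frac12[u_{x_0}(x_1)+u_{x_1}(x_0)]$. Then $\rho(x_0,x_1)=d(x_0,x_1)$ for all $x_0,x_1\in X$ if and only if for every pair of distinct points $x_0,x_1\in X$ there is a geodesic line passing through them.
   Context: A geodesic space is a length space in which the distance between any two points is attained by the length of some Lipschitz curve connecting them. For a non-empty closed set $H\subseteq X$, $d(x,H)=\inf_{h\in H}d(x,h)$. For $x_0\in X$ and $r>0$ let $S_r(x_0)=\{x\in X: d(x,x_0)=r\}$; then $u_{x_0}:X\to\mathbb{R}$ is defined by $u_{x_0}(x)=\lim_{r\to+\infty}[d(x,S_r(x_0))-r]$ (this limit exists for every $x$). A (unit speed) geodesic line is a curve $\gamma:\mathbb{R}\to X$ that is globally distance-minimizing: $d(\gamma(s),\gamma(t))=|s-t|$ for all $s,t\in\mathbb{R}$. *)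

(* Defs.v *)
From HB Require Import structures.
From mathcomp Require Import all_boot all_order all_algebra.
From mathcomp Require Import all_classical all_reals.
From mathcomp Require Import ereal topology normedtype numfun.

Set Implicit Arguments.
Unset Strict Implicit.
Unset Printing Implicit Defensive.

Import Order.TTheory GRing.Theory Num.Theory.
Import numFieldNormedType.Exports.

Local Open Scope classical_set_scope.
Local Open Scope ring_scope.

Section metric_geometry.
Context {R : realType}.

(* The axiom of [completeType], stated without requiring a distinguished point
   in the space. *)
Definition complete_space (X : metricType R) : Prop :=
  forall F : set_system X, ProperFilter F -> cauchy F -> exists x : X, F --> x.

Section curves.
Context {X : metricType R}.
Implicit Types (x y : X) (c g : R -> X) (H : set X).

(* Curves are parametrized by [0, 1]; the values of [c] outside of [0, 1] are
   irrelevant. *)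
Definition lipschitz_curve c : Prop :=
  exists L : R, forall s t : R, 0 <= s <= 1 -> 0 <= t <= 1 ->
    mdist (c s) (c t) <= L * `|s - t|.

Definition lipschitz_curve_between x y c : Prop :=
  [/\ lipschitz_curve c, c 0 = x & c 1 = y].

(* The analogue of [variation] for functions with values in a metric space:
   the sum of the d(c t_n, c t_n+1), where (t_0, t_1, ...) is [a :: s]. *)
Definition curve_variation (a b : R) c (s : seq R) : R :=
  let F := c \o nth b (a :: s) in
  \sum_(0 <= n < size s) mdist (F n) (F n.+1).

Definition curve_length c : \bar R :=
  ereal_sup [set (curve_variation 0 1 c s)%:E | s in itv_partition 0 1].

Definition distance_to x H : R := inf [set mdist x h | h in H].

Definition metric_sphere x (r : R) : set X := [set y | mdist y x = r].

Definition horofunction (x0 x : X) : R :=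
  lim ((distance_to x (metric_sphere x0 r) - r) @[r --> +oo]).

Definition rho (x0 x1 : X) : R :=
  - (1 / 2) * (horofunction x0 x1 + horofunction x1 x0).

Definition geodesic_line g : Prop :=
  forall s t : R, mdist (g s) (g t) = `|s - t|.

End curves.

Definition length_space (X : metricType R) : Prop :=
  forall x y : X,
    (mdist x y)%:E =
    ereal_inf [set curve_length c | c in lipschitz_curve_between x y].

Definition geodesic_space (X : metricType R) : Prop :=
  length_space X /\
  forall x y : X, exists2 c : R -> X,
    lipschitz_curve_between x y c & curve_length c = (mdist x y)%:E.

End metric_geometry.

(* Main.v *)
(* If x0 and x1 lie on a geodesic line, the line meets each large sphere around
   x0 at a point realizing the bound d(x1, S_r(x0)) - r >= -d(x0, x1), and
   symmetrically, so rho(x0, x1) = d(x0, x1).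

   Conversely, r |-> d(x, S_r(x0)) - r is nondecreasing for r >= d(x0, x), with
   limit u_x0(x) >= -d(x0, x). If rho = d, then both horofunctions attain their
   lower bound, hence d(x1, S_r(x0)) = r - d(x0, x1) for all r >= d(x0, x1):
   every pair x0, x1 extends beyond x1, up to an arbitrarily small error. Zorn
   gives a maximal isometric relation between subsets of R and X containing
   (0, x0) and (d(x0, x1), x1). Its domain is closed (X is complete), has no gap
   (X is geodesic) and no maximum (extension, with the error removed by local
   compactness), nor a minimum (by reversal); so it is R. This avoids the
   Hopf-Rinow theorem. *)
Require Import Defs.
From mathcomp Require Import all_boot all_order all_algebra.
From mathcomp Require Import all_classical all_reals.
From mathcomp Require Import ereal topology normedtype numfun.
From mathcomp Require Import realfun lra.

Import Order.TTheory GRing.Theory Num.Theory.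
Import numFieldNormedType.Exports.
Local Open Scope classical_set_scope.
Local Open Scope ring_scope.

Section geodesics.
Set Implicit Arguments.
Unset Strict Implicit.
Context {R : realType} {X : metricType R}.
Implicit Types (x y z p : X) (r s t e : R) (G : set (R * X)).

(** * Intermediate points on minimizing curves *)

Lemma ler_dist_mdist x y z : `|mdist x y - mdist x z| <= mdist y z.
Proof.
have := metric_triangle x y z; have := metric_triangle x z y.
by rewrite (metric_sym z y) => ? ?; rewrite ler_norml; apply/andP; split; lra.
Qed.

Lemma mdist_curve_le (c : R -> X) s : 0 <= s <= 1 ->
  curve_length c = (mdist (c 0) (c 1))%:E ->
  mdist (c 0) (c s) + mdist (c s) (c 1) = mdist (c 0) (c 1).
Proof.
move=> /andP[]; rewrite le_eqVlt => /predU1P[<-|s0]; first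
  by rewrite mdistxx add0r.
rewrite le_eqVlt => /predU1P[->|s1]; first by rewrite mdistxx addr0.
move=> cl; apply/eqP; rewrite eq_le metric_triangle andbT.
(* The partition 0 < s < 1, strict once the endpoints are set aside, bounds the length from
   below. *)
rewrite -lee_fin -cl; apply: ereal_sup_ubound; exists [:: s; 1] => /=.
  by split => //=; rewrite s0 s1.
by congr (_%:E); rewrite /curve_variation /= !big_nat_recl// big_geq// addr0.
Qed.

Lemma lipschitz_curve_continuous (c : R -> X) p : lipschitz_curve c ->
  {within `[0, 1], continuous (fun s => mdist p (c s))}.
Proof.
move=> [L cL]; apply/subspace_continuousP => s /=; rewrite in_itv/= => s01.
(* [L] may be zero or negative; |L| + 1 is a positive Lipschitz constant. *)
have L0 : 0 < `|L| + 1 by rewrite ltr_wpDl.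
apply/cvgrPdist_le => e e0; near=> t.
apply: (le_trans (ler_dist_mdist _ _ _)).
have t01 : 0 <= t <= 1.
  have : `[0, 1]%classic t by near: t; exact: withinT.
  by rewrite /= in_itv.
apply: (le_trans (cL _ _ s01 t01)).
have : `|s - t| <= e / (`|L| + 1).
  near: t; apply: cvg_within.
  by apply/nbhs_ballP; exists (e / (`|L| + 1)) => [|u /ltW//]; exact: divr_gt0.
rewrite ler_pdivlMr// mulrC; apply: le_trans.
by rewrite ler_wpM2r// (le_trans (ler_norm _))// lerDl.
Unshelve. all: by end_near. Qed.

(** Intermediate value theorem for the distance to [p] along a shortest curve from [x] to [y]. *)
Lemma geodesic_crossing p x y r : geodesic_space X ->
  mdist p x <= r <= mdist p y ->
  exists2 z, mdist p z = r & mdist x z + mdist z y = mdist x y.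
Proof.
move=> [_ /(_ x y)[c [cl c0 c1] cL]] xry; subst x y.
have pc := lipschitz_curve_continuous (p := p) cl.
have := IVT (v := r) ler01 pc.
case; first by rewrite ge_min le_max; case/andP: xry => -> ->; rewrite orbT.
move=> s.
by rewrite in_itv/= => s01 sr; exists (c s) => //; exact: mdist_curve_le.
Qed.

(** * Distances to spheres and horofunctions *)

Lemma distance_to_le x (H : set X) h : H h -> distance_to x H <= mdist x h.
Proof.
move=> Hh; apply: ge_inf; last by exists h.
by exists 0 => _ [y _ <-]; exact: mdist_ge0.
Qed.

Lemma le_distance_to x (H : set X) r : H !=set0 ->
  (forall h, H h -> r <= mdist x h) -> r <= distance_to x H.
Proof.
move=> [h Hh] rH; apply: lb_le_inf; first by exists (mdist x h), h.
by move=> _ [y Hy <-]; exact: rH.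
Qed.

Lemma distance_to_sphere_ge x0 x r : metric_sphere x0 r !=set0 ->
  - mdist x0 x <= distance_to x (metric_sphere x0 r) - r.
Proof.
move=> S0; rewrite lerBrDr; apply: le_distance_to => // h <-.
by have := metric_triangle h x x0; rewrite !(metric_sym h) (metric_sym x x0);
  lra.
Qed.

(** A geodesic from [x] to a point [h] of the larger sphere crosses the smaller one at some [z], and
    d(z, h) >= r' - r. *)
Lemma distance_to_sphere_nondecreasing x0 x r r' : geodesic_space X ->
    metric_sphere x0 r' !=set0 -> mdist x0 x <= r -> r <= r' ->
  distance_to x (metric_sphere x0 r) - r <=
    distance_to x (metric_sphere x0 r') - r'.
Proof.
move=> gX S0 xr rr'; rewrite lerBrDr; apply: le_distance_to => // h.
rewrite /metric_sphere/= metric_sym => hr'.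
have [|z zr zh] := @geodesic_crossing x0 x h r gX; first by rewrite xr hr'.
have := @distance_to_le x (metric_sphere x0 r) z.
rewrite /metric_sphere/= metric_sym => /(_ zr).
by have := metric_triangle x0 z h; lra.
Qed.

Lemma distance_to_sphere_le_horofunction x0 x r : geodesic_space X ->
    (forall r', 0 <= r' -> metric_sphere x0 r' !=set0) -> mdist x0 x <= r ->
  distance_to x (metric_sphere x0 r) - r <= horofunction x0 x.
Proof.
move=> gX S0 xr; set F := fun r => distance_to x (metric_sphere x0 r) - r.
set m := mdist x0 x in xr *.
have m0 : 0 <= m := mdist_ge0 _ _.
have Fmono r1 r2 : m <= r1 -> r1 <= r2 -> F r1 <= F r2.
  by move=> m1 r12; apply: distance_to_sphere_nondecreasing => //;
    apply: S0; lra.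
have cF : cvg (F r @[r --> +oo]).
  (* [F] is monotone only from [m] on, hence the truncation; the triangle inequality through [x0]
     bounds it above by [m]. *)
  apply/cvg_ex; exists (sup (range (fun r => F (Num.max r m)))).
  apply: cvg_trans (nondecreasing_cvgr _ _).
  - apply: near_eq_cvg; near=> t; congr F; apply/max_idPl.
    by near: t; apply: nbhs_pinfty_ge; exact: num_real.
  - move=> r1 r2 r12; apply: Fmono; first by rewrite le_max lexx orbT.
    by rewrite ge_max !le_max r12 lexx orbT.
  exists m => _ [t _ <-]; have : 0 <= Num.max t m by rewrite le_max m0 orbT.
  move: (Num.max t m) => u /S0[h hu]; have := @distance_to_le x _ _ hu.
  have := metric_triangle x x0 h; rewrite /F (metric_sym x x0);
  rewrite (metric_sym x0 h).
  by move: hu; rewrite /metric_sphere/= => ->; rewrite -/m; lra.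
apply: (limr_ge cF); near=> t; apply: (Fmono _ _ xr).
by near: t; apply: nbhs_pinfty_ge; exact: num_real.
Unshelve. all: by end_near. Qed.

Lemma horofunction_ge x0 x : geodesic_space X ->
    (forall r', 0 <= r' -> metric_sphere x0 r' !=set0) ->
  - mdist x0 x <= horofunction x0 x.
Proof.
move=> gX S0; apply: le_trans (distance_to_sphere_ge _ _) _; last first.
  exact: (distance_to_sphere_le_horofunction gX S0 (lexx _)).
by apply: S0; exact: mdist_ge0.
Qed.

(** * Horofunctions along geodesic lines *)

Lemma horofunction_geodesic_line (g : R -> X) s : geodesic_line g -> 0 <= s ->
  horofunction (g 0) (g s) = - s.
Proof.
move=> gl s0; apply: lim_near_cst => //; near=> r.
have sr : s <= r by near: r; apply: nbhs_pinfty_ge; exact: num_real.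
have Sr : metric_sphere (g 0) r (g r).
  by rewrite /metric_sphere/= gl subr0 ger0_norm//; lra.
apply/eqP; rewrite eq_le; apply/andP; split.
  by have := distance_to_le (g s) Sr; rewrite gl distrC;
    rewrite ger0_norm ?subr_ge0//; lra.
apply: le_trans (distance_to_sphere_ge _ _); last by exists (g r).
by rewrite gl sub0r normrN ger0_norm.
Unshelve. all: by end_near. Qed.

Lemma rho_geodesic_line (g : R -> X) s t : geodesic_line g ->
  rho (g s) (g t) = mdist (g s) (g t).
Proof.
move=> gl; wlog st : s t / s <= t.
  move=> wlg; have [|/ltW] := leP s t; first exact: wlg.
  by move=> /wlg; rewrite /rho addrC metric_sym.
have l1 : geodesic_line (fun u => g (s + u)).
  by move=> u v; rewrite gl; congr (`| _ |); lra.
have l2 : geodesic_line (fun u => g (t - u)).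
  by move=> u v; rewrite gl distrC; congr (`| _ |); lra.
have st0 : 0 <= t - s by lra.
have := horofunction_geodesic_line l1 st0.
have := horofunction_geodesic_line l2 st0.
rewrite addr0 subr0 subKr (addrC s) subrK /rho => -> ->.
by rewrite gl distrC ger0_norm//; lra.
Qed.

(** * Non-emptiness of spheres *)

(** Large spheres are empty and the infimum of the empty set is 0, so the function of the radius t
    is eventually -t; it diverges, and [lim] returns its default [point]. *)
Lemma horofunction_bounded x0 r : (forall x, mdist x x0 < r) ->
  forall x, horofunction x0 x = point.
Proof.
move=> br x; apply: dvgP => /cvgr_ge; set l := lim _.
have /[swap]/[apply] : l - 1 < l by lra.
move=> lF; near (pinfty_nbhs R) => t.
have : l - 1 <= distance_to x (metric_sphere x0 t) - t by near: t.
have -> : metric_sphere x0 t = set0.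
  apply/eqP/negPn/negP => /set0P[y yt]; have := br y.
  rewrite yt ltNge => /negP; apply.
  by near: t; apply: nbhs_pinfty_ge; exact: num_real.
rewrite /distance_to image_set0 inf0 sub0r.
apply/negP; rewrite -ltNge.
have : 1 - l < t by near: t; apply: nbhs_pinfty_gt; exact: num_real.
lra.
Unshelve. all: by end_near. Qed.

(* If some sphere is empty then X is bounded, the limits defining the
   horofunctions do not exist and rho is a constant junk value. *)
Lemma rho_eq_mdist_sphere : geodesic_space X -> ~ compact [set: X] ->
    (forall x y, rho x y = mdist x y) ->
  forall x0 r, 0 <= r -> metric_sphere x0 r !=set0.
Proof.
move=> gX ncX rhoE x0 r r0; apply/set0P/negP => /eqP S0.
have br x : mdist x x0 < r.
  rewrite ltNge; apply/negP => rx.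
  have [|z zr _] := @geodesic_crossing x0 x0 x r gX.
    by rewrite mdistxx r0 (metric_sym x0).
  by have /[!S0] : metric_sphere x0 r z by rewrite /metric_sphere/= metric_sym.
have hE x y : horofunction x y = point.
  apply: (@horofunction_bounded x (r + r)) => z.
  by have := metric_triangle z x0 x; have := br z; have := br x;
    rewrite (metric_sym x); lra.
(* As [rho] is constant, d(x, x0) = rho x x = 0: the space is a single point. *)
apply: ncX; have -> : [set: X] = [set x0]; last exact: compact_set1.
apply/seteqP; split => // x _ /=; apply: mdist_positivity.
by rewrite -rhoE -(mdistxx x) -rhoE /rho !hE.
Qed.

(** * Extension of pairs of points *)

(** The slack [e] is there because the distance from [x1] to the sphere is an infimum, not known to
    be attained. *)
Definition almost_extendible := forall x0 x1 r e, mdist x0 x1 <= r -> 0 < e ->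
  exists2 h, mdist x0 h = r & mdist x1 h < r - mdist x0 x1 + e.

Lemma rho_eq_mdist_almost_extendible :
    geodesic_space X -> ~ compact [set: X] ->
    (forall x y, rho x y = mdist x y) ->
  almost_extendible.
Proof.
move=> gX ncX rhoE x0 x1 r e xr e0.
have S0 := rho_eq_mdist_sphere gX ncX rhoE.
have := rhoE x0 x1; rewrite /rho => rE.
have := @horofunction_ge x0 x1 gX (S0 x0).
have := @horofunction_ge x1 x0 gX (S0 x1).
rewrite (metric_sym x1 x0) => h1 h0.
have := distance_to_sphere_le_horofunction gX (S0 x0) xr => Fh.
have Fr : distance_to x1 (metric_sphere x0 r) < r - mdist x0 x1 + e by lra.
have r0 : 0 <= r := le_trans (mdist_ge0 _ _) xr.
have [h hr] := S0 x0 r r0.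
have : [set mdist x1 h | h in metric_sphere x0 r] !=set0.
  by exists (mdist x1 h), h.
move=> /inf_lt/(_ Fr)[_ [y yr <-] yh]; exists y => //.
by rewrite metric_sym.
Qed.

(** * Partial lines and their one-point extensions *)

(** A relation, so that chains can be united by inclusion; the case s = t makes it functional. *)
Definition partial_line G := forall s x t y,
  G (s, x) -> G (t, y) -> mdist x y = `|s - t|.

Definition fits G t y := forall s x, G (s, x) -> mdist x y = `|s - t|.

(** Maximality of a partial line, tested one pair at a time. *)
Definition saturated G := forall t y, fits G t y -> G (t, y).

Definition reversal G : set (R * X) := [set sx | G (- sx.1, sx.2)].

Lemma partial_line_reversal G : partial_line G -> partial_line (reversal G).
Proof.
move=> GG s x t y Gs Gt; rewrite (GG _ _ _ _ Gs Gt) /= distrC.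
by congr `| _ |; lra.
Qed.

Lemma saturated_reversal G : saturated G -> saturated (reversal G).
Proof.
move=> sG t y fty; apply: sG => s x Gsx.
have : reversal G (- s, x) by rewrite /reversal/= opprK.
by move=> /fty ->; rewrite /= distrC; congr `| _ |; lra.
Qed.

(** Since [G] is isometric, its points with parameters tending to [t] form a Cauchy filter; its
    limit inherits the distances. *)
Lemma fits_limit G t : complete_space X -> partial_line G ->
    (forall e, 0 < e -> exists s x, G (s, x) /\ `|s - t| < e) ->
  exists y, fits G t y.
Proof.
move=> cX GG Gt.
pose B e := [set x | exists2 s, `|s - t| < e & G (s, x)].
have BF : ProperFilter (filter_from [set e : R | 0 < e] B).
  apply: filter_from_proper.
    apply: filter_from_filter; first by exists 1 => /=.
    move=> e1 e2 /= e10 e20; exists (Num.min e1 e2).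
      by rewrite /= lt_min e10.
    by move=> x [s]; rewrite lt_min => /andP[? ?] Gsx; split; exists s.
  by move=> e /Gt[s [x [Gsx se]]]; exists x, s.
have [|y By] := cX _ BF.
  apply/cauchy_ballP => e e0; exists (B (e / 2), B (e / 2)).
    by split; exists (e / 2) => //=; rewrite divr_gt0.
  move=> [x1 x2] /= [[s1 s1e G1] [s2 s2e G2]].
  rewrite ballEmdist/= (GG _ _ _ _ G1 G2).
  have -> : s1 - s2 = (s1 - t) - (s2 - t) by lra.
  by apply: (le_lt_trans (ler_normB _ _)); lra.
exists y => s x Gsx; apply/eqP; rewrite -subr_eq0 -normr_le0.
apply/ler_addgt0Pl => e e0; rewrite addr0.
have e20 : 0 < e / 2 by rewrite divr_gt0.
have /By : nbhs y (ball y (e / 2)) := nbhsx_ballx y _ e20.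
move=> [e' /= e'0 Be'].
have [s' [x' [Gs' ]]] :
    exists s' x', G (s', x') /\ `|s' - t| < Num.min (e / 2) e'.
  by apply: Gt; rewrite lt_min e20.
rewrite lt_min => /andP[se se'].
have : ball y (e / 2) x' by apply: Be'; exists s'.
rewrite ballEmdist/= => yx'.
have := ler_dist_mdist x y x'; rewrite (GG _ _ _ _ Gsx Gs') => h1.
have h2 : `| `|s - s'| - `|s - t| | <= `|s' - t|.
  rewrite (_ : s' - t = - ((s - s') - (s - t))); last lra.
  by rewrite normrN; exact: ler_dist_dist.
rewrite (_ : _ - _ = (mdist x y - `|s - s'|) + (`|s - s'| - `|s - t|));
  last lra.
by apply: (le_trans (ler_normD _ _)); lra.
Qed.

(** Take [y] at distance t - a from [p] on a geodesic from [p] to [q]. For parameters outside the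
    gap, the triangle inequalities through [p] and [q] pin d(x, y) from both sides. *)
Lemma fits_between G a b t p q : geodesic_space X -> partial_line G ->
    G (a, p) -> G (b, q) -> a <= t <= b ->
    (forall s x, G (s, x) -> s <= a \/ b <= s) ->
  exists y, fits G t y.
Proof.
move=> gX GG Ga Gb /andP[at_ tb] gap.
have pq := GG _ _ _ _ Ga Gb.
have pqE : mdist p q = b - a by rewrite pq distrC ger0_norm//; lra.
have [|y py yq] := @geodesic_crossing p p q (t - a) gX.
  by rewrite mdistxx pqE; apply/andP; split; lra.
exists y => s x Gsx; have xp := GG _ _ _ _ Gsx Ga; have xq := GG _ _ _ _ Gsx Gb.
have := metric_triangle x p y; have := metric_triangle x y q.
have := metric_triangle x q y; have := metric_triangle p y x.
have := metric_triangle p x y; rewrite (metric_sym q y) (metric_sym p x).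
rewrite (metric_sym y x) xp xq.
have [sa|bs] := gap _ _ Gsx.
  by rewrite !ler0_norm; lra.
by rewrite !ger0_norm; lra.
Qed.

(* Local compactness is needed only near the last point [p] of [G]: the
   candidates for the new point can be chosen in a fixed ball around [p], and
   those for [s] satisfy up to an error the constraints of all [s' >= s]. *)
Lemma fits_beyond_max G b p : locally_compact [set: X] -> partial_line G ->
    almost_extendible ->
    G (b, p) -> (forall s x, G (s, x) -> s <= b) ->
  exists t y, b < t /\ fits G t y.
Proof.
move=> lcX GG extX Gb maxb.
have [K] := lcX p I; rewrite withinET => /nbhs_ballP[e /= e0 eK] [cK _].
(* The new parameter will be b + d; candidates with error at most [d] stay within [e] of [p], hence
   in [K]. *)
pose d := e / 2; have d0 : 0 < d by rewrite divr_gt0.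
pose B (i : (R * X) * R) :=
  [set y | mdist p y < d + i.2 /\ b + d - i.1.1 <= mdist i.1.2 y].
pose F := filter_from [set i : (R * X) * R | G i.1 /\ 0 < i.2] B.
have FF : ProperFilter F.
  apply: filter_from_proper; last first.
    move=> [[s x] u] /= [Gsx u0].
    have sb := maxb _ _ Gsx.
    have xp : mdist x p = b - s by rewrite (GG _ _ _ _ Gsx Gb) ler0_norm; lra.
    (* Extending the pair [x], [p] to radius b + d - s with error [u] yields a candidate. *)
    have [||h xh ph] := extX x p (b + d - s) u; [lra|lra|].
    by exists h; split => /=; lra.
  apply: filter_from_filter; first by exists ((b, p), 1); split => //=.
  move=> [[s1 x1] u1] [[s2 x2] u2] /= [G1 u10] [G2 u20].
  have incl s s' x x' u u' : G (s, x) -> G (s', x') -> s <= s' -> u <= u' ->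
      B ((s, x), u) `<=` B ((s', x'), u').
    move=> Gs Gs' ss' uu' y [/= py xy]; split => /=; first lra.
    have := metric_triangle x x' y.
    by rewrite (GG _ _ _ _ Gs Gs') ler0_norm; lra.
  have m1 : Num.min u1 u2 <= u1 by rewrite ge_min lexx.
  have m2 : Num.min u1 u2 <= u2 by rewrite ge_min lexx orbT.
  have m0 : 0 < Num.min u1 u2 by rewrite lt_min u10.
  have [s12|/ltW s12] := leP s1 s2.
    by exists ((s1, x1), Num.min u1 u2) => //;
      rewrite subsetI; split; exact: incl.
  by exists ((s2, x2), Num.min u1 u2) => //;
      rewrite subsetI; split; exact: incl.
have FK : F K.
  exists ((b, p), d) => // y [/= py _]; apply: eK; rewrite ballEmdist/=.
  by apply: (lt_le_trans py); rewrite /d; lra.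
(* The constraints pass to the cluster point: d(p, y) <= d and d(x, y) >= b + d - s. As d(x, p) = b
   - s, the latter is an equality. *)
have [y [_ Fy]] := cK F FF FK.
have near_y i u : G i.1 -> 0 < i.2 -> 0 < u ->
    exists2 y', B i y' & mdist y y' < u.
  move=> Gi i0 u0.
  have [|y' [By' yy']] := Fy (B i) _ _ (nbhsx_ballx y u u0); first by exists i.
  by exists y' => //; rewrite ballEmdist in yy'.
have py : mdist p y <= d.
  apply/ler_addgt0Pr => u u0.
  have u20 : 0 < u / 2 by rewrite divr_gt0.
  have [y' [/= py' _] yy'] := near_y ((b, p), u / 2) _ Gb u20 u20.
  by have := metric_triangle p y' y; rewrite (metric_sym y' y); lra.
exists (b + d), y; split; first lra.
move=> s x Gsx; have sb := maxb _ _ Gsx.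
have xp : mdist x p = b - s by rewrite (GG _ _ _ _ Gsx Gb) ler0_norm; lra.
have := metric_triangle x p y.
have xy : b + d - s <= mdist x y.
  apply/ler_addgt0Pr => u u0.
  have [y' [/= _ xy'] yy'] := near_y ((s, x), 1) _ Gsx ltr01 u0.
  by have := metric_triangle x y y'; lra.
by rewrite ler0_norm; lra.
Qed.

(** * Saturated partial lines and their domains *)

Lemma saturated_extension G0 : partial_line G0 ->
  exists G, [/\ G0 `<=` G, partial_line G & saturated G].
Proof.
(* [A] is not asked to contain [G0], so that the union of the empty chain also lies in [P]. *)
move=> GG0; pose P := [set A | partial_line (A `|` G0)].
have [|A [PA maxA]] := @Zorn_bigcup _ P.
  move=> F FP totF s x t y.
  move=> [[A FA As]|G0s] [[B FB Bt]|G0t].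
  - have [AB|BA] := totF _ _ FA FB.
    + by apply: (FP _ FB); left => //; exact: AB.
    + by apply: (FP _ FA); left => //; exact: BA.
  - by apply: (FP _ FA); [left|right].
  - by apply: (FP _ FB); [right|left].
  - exact: GG0.
exists (A `|` G0); split => // t y fty.
apply: contrapT => nAty; apply: (maxA (A `|` [set (t, y)])).
  split; first exact: subsetUl.
  by move=> sub; apply: nAty; left; apply: sub; right.
suff H : partial_line ((A `|` G0) `|` [set (t, y)]) by rewrite /P/= setUAC.
move=> s1 x1 s2 x2 [G1|[-> ->]] [G2|[-> ->]].
- exact: PA.
- exact: fty.
- by rewrite metric_sym distrC; exact: fty.
- by rewrite mdistxx subrr normr0.
Qed.

Lemma saturated_closed G t :
    complete_space X -> partial_line G -> saturated G ->
    (forall e, 0 < e -> exists s x, G (s, x) /\ `|s - t| < e) ->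
  exists x, G (t, x).
Proof. by move=> cX GG sG /(fits_limit cX GG)[y /sG]; exists y. Qed.

(** The supremum of the parameters up to [t] is attained because the domain is closed. Applied to
    the reversal, this gives the least parameter above [t]. *)
Lemma saturated_sup G t u p :
    complete_space X -> partial_line G -> saturated G ->
    G (u, p) -> u <= t ->
  exists a x, [/\ G (a, x), a <= t &
    forall s y, G (s, y) -> s <= t -> s <= a].
Proof.
move=> cX GG sG Gu ut; pose D := [set s | s <= t /\ exists x, G (s, x)].
have supD : has_sup D.
  by split; [exists u; split=> //; exists p|exists t => s []].
have ubD s y : G (s, y) -> s <= t -> s <= sup D.
  by move=> Gs st; apply: ub_le_sup; [exact: supD.2|split => //; exists y].
have [|x Gx] := @saturated_closed G (sup D) cX GG sG.
  move=> e e0; have [s [st [x Gs]] se] := sup_adherent e0 supD.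
  exists s, x; split => //; rewrite ler0_norm; first by lra.
  by have := ubD _ _ Gs st; lra.
by exists (sup D), x; split => //; apply: ge_sup => [|s []//]; exact: supD.1.
Qed.

Lemma saturated_unbounded G t : complete_space X -> locally_compact [set: X] ->
    almost_extendible ->
    partial_line G -> saturated G -> G !=set0 ->
  exists s x, G (s, x) /\ t <= s.
Proof.
move=> cX lcX extX GG sG [[u p] Gu]; apply: contrapT => nt.
have ltt s x : G (s, x) -> s <= t.
  by move=> Gs; rewrite leNgt; apply/negP => /ltW ts; apply: nt; exists s, x.
have [a [x [Ga _ amax]]] := saturated_sup cX GG sG Gu (ltt _ _ Gu).
have {}amax s y : G (s, y) -> s <= a.
  by move=> Gs; apply: (amax s y Gs); exact: ltt Gs.
have [b [y [ab /sG Gb]]] := fits_beyond_max lcX GG extX Ga amax.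
by have := amax _ _ Gb; rewrite leNgt ab.
Qed.

Lemma saturated_total G t : geodesic_space X ->
    complete_space X -> locally_compact [set: X] ->
    almost_extendible ->
    partial_line G -> saturated G -> G !=set0 ->
  exists x, G (t, x).
Proof.
move=> gX cX lcX extX GG sG G0.
have GG' := partial_line_reversal GG; have sG' := saturated_reversal sG.
have G0' : reversal G !=set0.
  by have [[s x] Gs] := G0; exists (- s, x); rewrite /reversal/= opprK.
have [s1 [x1 [Gs1 s1t]]] := saturated_unbounded (- t) cX lcX extX GG' sG' G0'.
have [s2 [x2 [Gs2 s2t]]] := saturated_unbounded t cX lcX extX GG sG G0.
have s1t' : - s1 <= t by lra.
have s2t' : - s2 <= - t by lra.
have Gs2' : reversal G (- s2, x2) by rewrite /reversal/= opprK.
have [a [p [Ga at_ amax]]] := saturated_sup cX GG sG Gs1 s1t'.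
have [b [q [Gb bt bmax]]] := saturated_sup cX GG' sG' Gs2' s2t'.
have {}Gb : G (- b, q) by [].
(* [a] and [- b] are the parameters nearest to [t] on either side, so no parameter lies strictly
   between them. *)
have [||y /sG] := fits_between gX GG Ga Gb (t := t).
- by apply/andP; split; lra.
- move=> s x Gs; have [st|/ltW ts] := leP s t; first by left; exact: amax Gs st.
  right; have : - s <= b by apply: (bmax _ x); [rewrite /reversal/= opprK|lra].
  by lra.
by exists y.
Qed.

Lemma geodesic_line_through x0 x1 : geodesic_space X ->
    complete_space X -> locally_compact [set: X] ->
    almost_extendible ->
  exists g : R -> X, [/\ geodesic_line g, g 0 = x0 & g (mdist x0 x1) = x1].
Proof.
move=> gX cX lcX extX.
pose G0 : set (R * X) := [set (0, x0); (mdist x0 x1, x1)].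
have d0 := mdist_ge0 x0 x1.
have [|G [G0G GG sG]] := @saturated_extension G0.
  move=> s x t y [|] [-> ->] [|] [-> ->].
  - by rewrite mdistxx subrr normr0.
  - by rewrite sub0r normrN ger0_norm.
  - by rewrite metric_sym subr0 ger0_norm.
  - by rewrite mdistxx subrr normr0.
have G1 : G (0, x0) by apply: G0G; left.
have G2 : G (mdist x0 x1, x1) by apply: G0G; right.
have /choice[g gG] : forall t, exists x, G (t, x).
  by move=> t; apply: saturated_total => //; exists (0, x0).
exists g; split; first by move=> s t; exact: GG.
  by apply: mdist_positivity; rewrite (GG _ _ _ _ (gG _) G1) subrr normr0.
by apply: mdist_positivity; rewrite (GG _ _ _ _ (gG _) G2) subrr normr0.
Qed.

End geodesics.

(** * Equality of [rho] with the distance and lines through pairs *)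

Theorem theorem5p4 (R : realType) (X : metricType R)
    (X_complete : complete_space X)
    (X_connected : connected [set: X])
    (X_locally_compact : locally_compact [set: X])
    (X_noncompact : ~ compact [set: X])
    (X_geodesic : geodesic_space X) :
  (forall x0 x1 : X, rho x0 x1 = mdist x0 x1) <->
  (forall x0 x1 : X, x0 <> x1 ->
     exists2 g : R -> X, geodesic_line g &
       (exists s : R, g s = x0) /\ (exists t : R, g t = x1)).
Proof.
split=> [rhoE x0 x1 _|lines x0 x1].
  have extX := rho_eq_mdist_almost_extendible X_geodesic X_noncompact rhoE.
  have [g [gl g0 g1]] :=
    geodesic_line_through x0 x1 X_geodesic X_complete X_locally_compact extX.
  by exists g => //; split; [exists 0|exists (mdist x0 x1)].
have [<-|] := pselect (x0 = x1); last first.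
  by move=> /lines[g gl [[s <-] [t <-]]]; exact: rho_geodesic_line.
(* Lines are given for distinct points only: when x0 = x1, non-compactness supplies another point,
   and any line through [x0] serves. *)
have [y xy] : exists y, x0 <> y.
  apply: contrapT => nxy; apply: X_noncompact.
  suff -> : [set: X] = [set x0] by exact: compact_set1.
  by apply/seteqP; split => // y _; apply: contrapT => yx;
    apply: nxy; exists y => /esym.
by have [g gl [[s <-] _]] := lines _ _ xy; exact: rho_geodesic_line.
Qed.
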